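(* Let $\mathbb{K}$ be a field. There are, up to isomorphism, exactly $20$ square free monomial Cremona sets $F=\{f_1,\dots,f_6\}$ of degree $3$ in $\mathbb{K}[x_1,\dots,x_6]$ of type 2, i.e. whose log matrix $A_F$ has a row with five entries equal to $1$.
   Context: Let $F=\{f_1,\dots,f_n\}$ be a set of $n$ monomials of the same degree $d$ in $\mathbb{K}[x_1,\dots,x_n]$; write $f_j=x_1^{v_{1j}}\cdots x_n^{v_{nj}}$. The log matrix of $F$ is $A_F=(v_{ij})_{n\times n}$, so rows correspond to variables and columns to monomials. $F$ is square free if all $v_{ij}\in\{0,1\}$. $F$ is a Cremona set if the extension $\mathbb{K}[f_1,\dots,f_n]\subset \mathbb{K}[\underline{x}_d]$ becomes an equality on the level of fields of fractions, where $\mathbb{K}[\underline{x}_d]$ is the algebra generated by all monomials of degree $d$ in $x_1,\dots,x_n$ (equivalently, the rational map $\mathbb{P}^{n-1}\dashrightarrow\mathbb{P}^{n-1}$ given by $(f_1:\dots:f_n)$ is birational). Standing assumption (canonical restrictions): for each $j$ there is a $k$ with $x_j\mid f_k$ and there is a $k$ with $x_j\nmid f_k$. Two Cremona sets $F,F'$ are isomorphic if $F'=\sigma(F)$ (as unordered sets) for some $\sigma\in S_n$ acting by permutation of the variables. *)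

(* Defs.v *)
From mathcomp Require Import all_boot all_order all_algebra all_fingroup.
From mathcomp Require Import fraction finmap mpoly.

Set Implicit Arguments.
Unset Strict Implicit.
Unset Printing Implicit Defensive.

Import GRing.Theory.
Local Open Scope ring_scope.

(* A monomial is encoded by its exponent vector m : 'X_{1..n}; the polynomial *)
(* itself is 'X_[K, m].  A set of monomials is a term of {fset 'X_{1..n}}.    *)

(* The columns are listed in the order of the enumeration of F; only          *)
(* properties independent of that order are used.                             *)
Definition log_matrix (n : nat) (F : {fset 'X_{1..n}}) : 'M[nat]_(n, #|` F|) :=
  \matrix_(i < n, j < #|` F|) tnth (in_tuple F) j i.

Definition square_free (n : nat) (F : {fset 'X_{1..n}}) : Prop :=
  forall i j, log_matrix F i j \in [:: 0; 1]%N.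

Definition same_degree (n d : nat) (F : {fset 'X_{1..n}}) : Prop :=
  forall m, m \in F -> mdeg m = d.

(* On exponent vectors, <= is the componentwise order, i.e. divisibility. *)
Definition canonical_restrictions (n : nat) (F : {fset 'X_{1..n}}) : Prop :=
  forall i : 'I_n,
    (exists2 m, m \in F & (U_(i) <= m)%MM) /\
    (exists2 m, m \in F & ~~ (U_(i) <= m)%MM).

(* p belongs to the K-subalgebra of K[x_1, .., x_n] generated by the (possibly *)
(* infinite) set M of monomials.                                               *)
Definition mon_alg (K : fieldType) (n : nat) (M : {pred 'X_{1..n}})
    (p : {mpoly K[n]}) : Prop :=
  exists (k : nat) (t : k.-tuple 'X_{1..n}) (q : {mpoly K[k]}),
    {subset t <= M} /\ p = q \mPo [tuple 'X_[K, tnth t i] | i < k].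

(* The field of fractions of that subalgebra, inside K(x_1, .., x_n). *)
Definition mon_alg_frac (K : fieldType) (n : nat) (M : {pred 'X_{1..n}})
    (z : {fraction {mpoly K[n]}}) : Prop :=
  exists a b : {mpoly K[n]},
    [/\ mon_alg M a, mon_alg M b, b != 0 & z = tofrac a / tofrac b].

(* A set of n monomials of degree d in n variables, subject to the standing   *)
(* canonical restrictions, such that K[F] and K[x_d] have the same field of   *)
(* fractions.                                                                 *)
Definition cremona_set (K : fieldType) (n d : nat) (F : {fset 'X_{1..n}}) :
    Prop :=
  [/\ #|` F| = n, same_degree d F, canonical_restrictions F &
      forall z : {fraction {mpoly K[n]}},
        mon_alg_frac [pred m | m \in F] z <->
        mon_alg_frac [pred m | mdeg m == d] z].

Definition type2 (n : nat) (F : {fset 'X_{1..n}}) : Prop :=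
  exists i : 'I_n, #|[set j | log_matrix F i j == 1%N]| = 5%N.

(* The monomial obtained from 'X_[m] by the substitution x_i |-> x_(s i); it  *)
(* is the exponent vector of msym s 'X_[m] (see msymX).                       *)
Definition perm_mon (n : nat) (s : 'S_n) (m : 'X_{1..n}) : 'X_{1..n} :=
  [multinom m ((s^-1)%g i) | i < n].

Definition mon_iso (n : nat) (F F' : {fset 'X_{1..n}}) : Prop :=
  exists s : 'S_n, F' = [fset perm_mon s m | m in F]%fset.

(* P consists of exactly k classes for the equivalence relation R. *)
Definition exactly_up_to (T : Type) (R : T -> T -> Prop) (k : nat)
    (P : T -> Prop) : Prop :=
  exists r : 'I_k -> T,
    [/\ forall i, P (r i),
        forall i j, R (r i) (r j) -> i = j &
        forall x, P x -> exists i, R x (r i)].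

(* Main.v *)
(* If F is a Cremona set, an integer weight on the variables that vanishes on F
   vanishes on every monomial of degree d, hence is zero; conversely F is a
   Cremona set as soon as every x_i / x_0 and x_0 ^ 3 is a Laurent monomial in
   the elements of F. After a relabelling, the variable dividing five of the
   monomials is x_0 and the sixth monomial is x_1 x_2 x_3, so that F consists of
   x_1 x_2 x_3 and of the x_0 x_a x_b for the edges ab of a graph with five edges
   on {1, .., 5}. Each of these 252 sets is either killed by a nonzero weight, or
   in the orbit of one of 20 representatives under the relabellings that
   preserve {1, 2, 3}; these representatives are Cremona sets and pairwise non
   isomorphic. *)

Require Import Defs.
From mathcomp Require Import all_boot all_order all_algebra all_fingroup.
From mathcomp Require Import fraction finmap mpoly.

Set Implicit Arguments.
Unset Strict Implicit.
Unset Printing Implicit Defensive.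

Import GRing.Theory Num.Theory.

(** * Fields of fractions of monomial algebras *)

Section Cremona.

Local Open Scope ring_scope.

(** Serves as the induction principle for the subalgebra generated by [t], whose elements [mon_alg]
    presents through an arbitrary [q]. *)
Lemma comp_mpoly_ind (R : comNzRingType) (n k : nat)
    (t : n.-tuple {mpoly R[k]}) (P : {mpoly R[k]} -> Prop) :
    (forall c, P c%:MP) ->
    (forall p q, P p -> P q -> P (p + q)) ->
    (forall p q, P p -> P q -> P (p * q)) ->
    (forall i, P (tnth t i)) ->
  forall q, P (q \mPo t).
Proof.
move=> PC PD PM Pt q; rewrite comp_mpolyEX.
apply: (big_ind P) => [||m _]; [by rewrite -mpolyC0 | exact: PD |].
rewrite -mul_mpolyC; apply: (PM) => //; rewrite comp_mpolyX.
apply: (big_ind P) => [||i _]; [by rewrite -mpolyC1 | exact: PM |].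
by elim: (m i) => [|e IHe]; rewrite ?expr0 -?mpolyC1 // exprS; apply: PM.
Qed.

Lemma tofrac_div_inj (R : idomainType) (a b c d : R) :
    b != 0 -> d != 0 ->
  tofrac a / tofrac b = tofrac c / tofrac d -> a * d = c * b.
Proof.
move=> b0 d0 /eqP; rewrite eqr_div ?tofrac_eq0 // -!tofracM tofrac_eq.
by move/eqP.
Qed.

Lemma mon_alg_mon (K : fieldType) (n : nat) (M : {pred 'X_{1..n}}) m :
  m \in M -> mon_alg (K := K) M 'X_[m].
Proof.
move=> Mm; exists 1%N, [tuple m], 'X_ord0; split=> [x|].
  by rewrite inE => /eqP->.
by rewrite comp_mpolyXU -tnth_nth tnth_mktuple (tnth_nth m).
Qed.

Lemma mon_alg_sub (K : fieldType) (n : nat) (M N : {pred 'X_{1..n}}) p :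
  {subset M <= N} -> mon_alg (K := K) M p -> mon_alg N p.
Proof.
move=> sMN [k [t [q [tM ->]]]]; exists k, t, q; split=> // m /tM; exact: sMN.
Qed.

(** The polynomials supported in a submonoid [W] of exponents form a subalgebra, and this one
    contains the generators. *)
Lemma mon_alg_msupp (K : fieldType) (n : nat) (M : {pred 'X_{1..n}})
    (W : {pred 'X_{1..n}}) p :
    0%MM \in W -> (forall a b, a \in W -> b \in W -> (a + b)%MM \in W) ->
    {subset M <= W} ->
  mon_alg (K := K) M p -> {subset msupp p <= W}.
Proof.
move=> W0 WD sMW [k [t [q [tM ->]]]].
apply: (comp_mpoly_ind (P := fun p => {subset msupp p <= W})).
- move=> c m; rewrite msuppC; case: ifP => // _; rewrite inE => /eqP->.
  exact: W0.
- move=> p1 p2 W1 W2 m /msuppD_le; rewrite mem_cat => /orP[/W1|/W2] //.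
- move=> p1 p2 W1 W2 m /msuppM_le /allpairsP[[a b] /= [/W1 Wa /W2 Wb ->]].
  exact: WD.
- move=> i m; rewrite tnth_mktuple msuppX inE => /eqP->.
  exact/sMW/tM/mem_tnth.
Qed.

(** * Weights on the variables *)

Definition weight (n : nat) (w : 'I_n -> int) (m : 'X_{1..n}) : int :=
  \sum_i w i *+ m i.

Lemma weight0 n (w : 'I_n -> int) : weight w 0%MM = 0.
Proof. by apply: big1 => i _; rewrite mnm0E. Qed.

Lemma weightD n (w : 'I_n -> int) a b :
  weight w (a + b)%MM = weight w a + weight w b.
Proof.
by rewrite -big_split; apply: eq_bigr => i _; rewrite mnmDE mulrnDr.
Qed.

Lemma weightU n (w : 'I_n -> int) i d : weight w (U_(i) *+ d)%MM = w i *+ d.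
Proof.
rewrite /weight (bigD1 i) //= big1 ?addr0 => [|j ji].
  by rewrite mulmnE mnm1E eqxx mul1n.
by rewrite mulmnE mnm1E eq_sym (negPf ji).
Qed.

(* A weight vanishing on F makes every element of K(F) a quotient of isobaric
   elements of weight zero, and [x_i ^ d] is such a quotient. *)
Lemma cremona_weight (K : fieldType) (n d : nat) (F : {fset 'X_{1..n}})
    (w : 'I_n -> int) :
    (0 < d)%N -> cremona_set K d F -> (forall m, m \in F -> weight w m = 0) ->
  forall i, w i = 0.
Proof.
move=> d0 [_ _ _ eqF] wF i.
pose W := [pred m : 'X_{1..n} | weight w m == 0].
have W0 : 0%MM \in W by rewrite inE weight0.
have WD a b : a \in W -> b \in W -> (a + b)%MM \in W.
  by rewrite !inE weightD => /eqP-> /eqP->.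
have sFW : {subset [pred m | m \in F] <= W}.
  by move=> m /wF; rewrite inE => ->.
have [|a [b [Fa Fb b0]]] := (eqF (tofrac 'X_[K, (U_(i) *+ d)%MM])).2.
  exists 'X_[K, (U_(i) *+ d)%MM], 1; split.
  - by apply: mon_alg_mon; rewrite inE mdegMn mdeg1 mul1n.
  - exists 0%N, [tuple], 1; split=> //; first by rewrite comp_mpoly1.
  - exact: oner_neq0.
  - by rewrite tofrac1 divr1.
rewrite -[X in X = _]divr1 -tofrac1 => /tofrac_div_inj.
rewrite oner_neq0 b0 mulr1 => /(_ isT isT) eqab.
(* Since x_i^d b = a, a monomial of [b] times x_i^d is a monomial of [a]; both have weight zero,
   hence so does x_i^d. *)
have [m bm] : exists m, m \in msupp b.
  case E: (msupp b) b0 => [|m s]; last by exists m; rewrite inE eqxx.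
  by rewrite (msuppnil0 E) eqxx.
have /(mon_alg_msupp W0 WD sFW Fa) : (U_(i) *+ d + m)%MM \in msupp a.
  by rewrite -eqab mulrC (perm_mem (msuppMX _ _)) map_f.
have := mon_alg_msupp W0 WD sFW Fb bm; rewrite !inE weightD => /eqP->.
by rewrite addr0 weightU mulrn_eq0 -[d == _]negbK -lt0n d0 /= => /eqP.
Qed.

(** In [mon_alg] each element brings its own tuple of generators. With the enumeration of [F] as
    common tuple, sums and products stay in the algebra. *)
Lemma mon_alg_fset (K : fieldType) (n : nat) (F : {fset 'X_{1..n}}) p :
  mon_alg (K := K) [pred m | m \in F] p <->
  exists q, p = q \mPo [tuple 'X_[K, tnth (in_tuple F) i] | i < #|` F|].
Proof.
split=> [[k [t [q [tF ->]]]]|[q ->]]; last first.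
  by exists #|` F|, (in_tuple F), q; split.
set u := [tuple _ | i < #|` F|].
apply: (comp_mpoly_ind (P := fun p => exists q, p = q \mPo u)).
- by move=> c; exists c%:MP; rewrite comp_mpolyC.
- by move=> _ _ [q1 ->] [q2 ->]; exists (q1 + q2); rewrite comp_mpolyD.
- by move=> _ _ [q1 ->] [q2 ->]; exists (q1 * q2); rewrite rmorphM.
- move=> i; rewrite tnth_mktuple.
  have /(tnthP (in_tuple F))[j ->] : tnth t i \in F by apply/tF/mem_tnth.
  by exists 'X_j; rewrite comp_mpolyXU -tnth_nth tnth_mktuple.
Qed.

(** * Laurent monomials in the elements of F *)

Section FsetAlgebra.

Variables (K : fieldType) (n : nat) (F : {fset 'X_{1..n}}).
Local Notation algF := (mon_alg (K := K) [pred m | m \in F]).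

Lemma mon_algC c : algF c%:MP.
Proof. by apply/mon_alg_fset; exists c%:MP; rewrite comp_mpolyC. Qed.

Lemma mon_algD p q : algF p -> algF q -> algF (p + q).
Proof.
move=> /mon_alg_fset[p' ->] /mon_alg_fset[q' ->]; apply/mon_alg_fset.
by exists (p' + q'); rewrite comp_mpolyD.
Qed.

Lemma mon_algM p q : algF p -> algF q -> algF (p * q).
Proof.
move=> /mon_alg_fset[p' ->] /mon_alg_fset[q' ->]; apply/mon_alg_fset.
by exists (p' * q'); rewrite rmorphM.
Qed.

(** Every generator has a monomial denominator in K[F], and the product of two denominators clears
    both a sum and a product. *)
Lemma mon_alg_clear (M : {pred 'X_{1..n}}) p :
    (forall m, m \in M -> exists2 b, algF 'X_[b] & algF 'X_[m + b]) ->
  mon_alg M p -> exists2 b, algF 'X_[b] & algF ('X_[b] * p).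
Proof.
move=> MF [k [t [q [tM ->]]]].
apply: (comp_mpoly_ind (P := fun p => exists2 b, algF 'X_[b] & algF (_ * p))).
- move=> c; exists 0%MM; rewrite mpolyX0 ?mul1r; last exact: mon_algC.
  by rewrite -mpolyC1; apply: mon_algC.
- move=> p1 p2 [b1 Fb1 Fp1] [b2 Fb2 Fp2]; exists (b1 + b2)%MM.
    by rewrite mpolyXD; apply: mon_algM.
  rewrite mpolyXD mulrDr -mulrA mulrCA -[X in _ + X]mulrA.
  by apply: mon_algD; apply: mon_algM.
- move=> p1 p2 [b1 Fb1 Fp1] [b2 Fb2 Fp2]; exists (b1 + b2)%MM.
    by rewrite mpolyXD; apply: mon_algM.
  by rewrite mpolyXD mulrACA; apply: mon_algM.
- move=> i; have [b Fb Fmb] := MF _ (tM _ (mem_tnth i t)); exists b => //.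
  by rewrite tnth_mktuple -mpolyXD addmC.
Qed.

(* m / m' is a quotient of two monomials of K[F]. *)
Definition eqmod (m m' : 'X_{1..n}) : Prop :=
  exists a b, [/\ algF 'X_[a], algF 'X_[b] & (m + b = m' + a)%MM].

Lemma eqmod_refl m : eqmod m m.
Proof.
by exists 0%MM, 0%MM; split=> //; rewrite mpolyX0 -mpolyC1; apply: mon_algC.
Qed.

Lemma eqmod_trans m1 m2 m3 : eqmod m1 m2 -> eqmod m2 m3 -> eqmod m1 m3.
Proof.
move=> [a [b [Fa Fb e]]] [a' [b' [Fa' Fb' e']]].
exists (a + a')%MM, (b + b')%MM; rewrite !mpolyXD; split; try exact: mon_algM.
rewrite addmA e -addmA [(a + b')%MM]addmC addmA e' -!addmA.
by rewrite [(a' + a)%MM]addmC.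
Qed.

Lemma eqmodD m1 m2 m3 m4 :
  eqmod m1 m2 -> eqmod m3 m4 -> eqmod (m1 + m3)%MM (m2 + m4)%MM.
Proof.
move=> [a [b [Fa Fb e]]] [a' [b' [Fa' Fb' e']]].
exists (a + a')%MM, (b + b')%MM; rewrite !mpolyXD; split; try exact: mon_algM.
apply/mnmP=> i; move/mnmP/(_ i): e; move/mnmP/(_ i): e'.
by rewrite !mnmDE => e' e; rewrite addnACA e e' addnACA.
Qed.

Lemma eqmodMn m1 m2 k : eqmod m1 m2 -> eqmod (m1 *+ k)%MM (m2 *+ k)%MM.
Proof.
move=> e; elim: k => [|k IHk]; first by rewrite !mulm0n; apply: eqmod_refl.
by rewrite !mulmS; apply: eqmodD.
Qed.

(** Once all variables are congruent to x_i0, only the total degree of a monomial matters. *)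
Lemma eqmod_mdeg i0 m :
  (forall i, eqmod U_(i)%MM U_(i0)%MM) -> eqmod m (U_(i0) *+ mdeg m)%MM.
Proof.
move=> eU; rewrite mdegE [X in eqmod X _]multinomUE_id.
elim/big_rec2: _ => [|i d m' _ IH]; first by rewrite mulm0n; apply: eqmod_refl.
have ->: (U_(i0) *+ (m i + d) = U_(i0) *+ m i + U_(i0) *+ d)%MM.
  by apply/mnmP => j; rewrite mnmDE !mulmnE mulnDr.
by apply: eqmodD => //; apply: eqmodMn.
Qed.

(** Every monomial of degree d is congruent to x_i0^d, hence to 1, so it is a quotient of monomials
    of K[F]. *)
Lemma cremona_of_eqmod (d : nat) (i0 : 'I_n) :
    #|` F| = n -> same_degree d F -> canonical_restrictions F ->
    (forall i, eqmod U_(i)%MM U_(i0)%MM) -> eqmod (U_(i0) *+ d)%MM 0%MM ->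
  cremona_set K d F.
Proof.
move=> cF dF canF eU eU0; split=> // z; split.
  move=> [a [b [Fa Fb b0 ->]]]; exists a, b; split=> //.
    by apply: mon_alg_sub Fa => m; rewrite !inE => /dF->.
  by apply: mon_alg_sub Fb => m; rewrite !inE => /dF->.
have clr m : m \in [pred m : 'X_{1..n} | mdeg m == d] ->
    exists2 b, algF 'X_[b] & algF 'X_[m + b].
  rewrite inE => /eqP dm; have := eqmod_mdeg m eU; rewrite dm.
  by move=> /eqmod_trans/(_ eU0)[a [b [Fa Fb e]]]; exists b; rewrite // e add0m.
move=> [p [q [dp dq q0 ->]]].
have [b Fb Fbp] := mon_alg_clear clr dp.
have [c Fc Fcq] := mon_alg_clear clr dq.
have X0 m : 'X_[m] != 0 :> {mpoly K[n]} by rewrite -msupp_eq0 msuppX.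
(* Expanding p / q by both denominators puts numerator and denominator in K[F]. *)
exists ('X_[c] * ('X_[b] * p)), ('X_[b] * ('X_[c] * q)); split.
- exact: mon_algM.
- exact: mon_algM.
- by rewrite !mulf_neq0.
- by rewrite mulrCA !tofracM -!mulf_div !divff ?mul1r ?tofrac_eq0.
Qed.

End FsetAlgebra.

End Cremona.

(** * Exponent vectors as lists *)

Section ExponentVectors.

Variable n : nat.
Implicit Types (v : seq nat) (V : seq (seq nat)) (m : 'X_{1..n}).
Implicit Types F : {fset 'X_{1..n}}.

(** Missing entries count as 0, so that [[:: 3]] and [[::]] stand for x_0^3 and 1. *)
Definition expo v : 'X_{1..n} := [multinom nth 0 v i | i < n].

Definition fset_of V : {fset 'X_{1..n}} := [fset expo v | v in V]%fset.

(** When [p] enumerates the variables, this is the exponent vector after renaming the j-th variable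
    of [p] to x_j; [pull] is its analogue on lists. *)
Definition readout (p : seq 'I_n) m : seq nat := [seq m i | i <- p].

Definition pull (p v : seq nat) : seq nat := [seq nth 0 v j | j <- p].

Lemma expoE v (i : 'I_n) : expo v i = nth 0 v i.
Proof. exact: mnmE. Qed.

Lemma readout_expo v : size v = n -> readout (enum 'I_n) (expo v) = v.
Proof.
move=> sv; apply: (@eq_from_nth _ 0) => [|j]; rewrite size_map size_enum_ord //.
move=> jn; rewrite (nth_map (Ordinal jn)) ?size_enum_ord // expoE.
by rewrite nth_enum_ord.
Qed.

Lemma expo_inj : {in [pred v | size v == n] &, injective expo}.
Proof.
move=> u v; rewrite !inE => /eqP su /eqP sv e.
by rewrite -(readout_expo su) e readout_expo.
Qed.

Lemma readout_inj p : perm_eq p (enum 'I_n) -> injective (readout p).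
Proof.
move=> /perm_mem pE m m' /eq_in_map e; apply/mnmP => i.
by apply: e; rewrite pE mem_enum.
Qed.

Lemma sumn_readout p m : perm_eq p (enum 'I_n) -> sumn (readout p m) = mdeg m.
Proof.
by move=> pE; rewrite sumnE big_map (perm_big _ pE) big_enum mdegE.
Qed.

Lemma fset_ofP V m :
  reflect (exists2 v, v \in V & m = expo v) (m \in fset_of V).
Proof. exact: imfsetP. Qed.

Lemma mem_fset_of V v : v \in V -> expo v \in fset_of V.
Proof. by move=> Vv; apply/fset_ofP; exists v. Qed.

Lemma perm_fset_of V :
  uniq V -> all (fun v => size v == n) V -> perm_eq (fset_of V) (map expo V).
Proof.
move=> uV /allP sV; apply: uniq_perm; first exact: fset_uniq.
  rewrite map_inj_in_uniq // => u v /sV su /sV sv; exact: expo_inj.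
move=> m; apply/idP/idP => [/fset_ofP[v Vv ->]|/mapP[v Vv ->]].
  exact: map_f.
exact: mem_fset_of.
Qed.

(** The relabelling is the inverse of j |-> p_j, because [perm_mon] itself composes with an
    inverse. *)
Lemma mon_iso_readout F V p :
    perm_eq p (enum 'I_n) -> [seq readout p m | m <- F] =i V ->
  mon_iso F (fset_of V).
Proof.
move=> pE FV; have sp : size p = n by rewrite (perm_size pE) size_enum_ord.
have up : uniq p by rewrite (perm_uniq pE) enum_uniq.
have f_inj : injective (fun j : 'I_n => tnth (Tuple (introT eqP sp)) j).
  move=> i j; rewrite !(tnth_nth i) /= => /eqP.
  by rewrite nth_uniq ?sp // => /eqP/val_inj.
have permE m : perm_mon (perm f_inj)^-1%g m = expo (readout p m).
  apply/mnmP => j; rewrite mnmE invgK permE expoE (nth_map j) ?sp //.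
  by rewrite (tnth_nth j).
exists (perm f_inj)^-1%g; apply/fsetP => m.
apply/fset_ofP/imfsetP => /= [[v]|[m' Fm' ->]].
  by rewrite -FV => /mapP[m' Fm' ->] ->; exists m'.
by exists (readout p m'); rewrite -?FV ?map_f.
Qed.

(** Yields a necessary condition for isomorphism that can be refuted by running through all
    permutations. *)
Lemma mon_iso_fset_of V V' :
    all (fun v => size v == n) V' -> mon_iso (fset_of V) (fset_of V') ->
  exists2 p, p \in permutations (iota 0 n) & all (fun v => pull p v \in V') V.
Proof.
move=> /allP sV' [s e].
exists [seq val ((s^-1)%g i) | i <- enum 'I_n].
  rewrite mem_permutations -val_enum_ord; apply: uniq_perm.
  - rewrite (map_comp val) map_inj_uniq; last exact: val_inj.
    by rewrite map_inj_uniq ?enum_uniq //; apply: perm_inj.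
  - by rewrite map_inj_uniq ?enum_uniq //; apply: val_inj.
  move=> x; apply/mapP/mapP => /= [[i _ ->]|[i _ ->]].
    by exists ((s^-1)%g i); rewrite ?mem_enum.
  by exists (s i); rewrite ?mem_enum ?permK.
apply/allP => v Vv.
have /fset_ofP[v' V'v' e'] : perm_mon s (expo v) \in fset_of V'.
  by rewrite e; apply/imfsetP; exists (expo v) => //; apply: mem_fset_of.
suff -> : pull [seq val ((s^-1)%g i) | i <- enum 'I_n] v = v' by [].
have /eqP sv' := sV' _ V'v'.
rewrite -(readout_expo sv') -e' /pull -map_comp.
by apply: eq_map => i; rewrite /= mnmE expoE.
Qed.

Lemma square_freeP F :
  square_free F <-> forall m i, m \in F -> m i <= 1.
Proof.
split=> [sF m i Fm|sF i j]; last first.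
  rewrite mxE !inE; have := sF _ i (mem_tnth j (in_tuple F)).
  by case: (_ i) => [|[]].
have /(tnthP (in_tuple F))[j ->] : m \in F by [].
by have := sF i j; rewrite mxE !inE => /orP[]/eqP->.
Qed.

Lemma card_log_matrix1 F i :
  #|[set j | log_matrix F i j == 1]| = count (fun m => m i == 1) F.
Proof.
rewrite -sum1_card -sum1_count (big_tuple _ _ (in_tuple F)).
by apply: eq_bigl => j; rewrite inE mxE.
Qed.

End ExponentVectors.

(** * The finite classification *)

Definition indic (A : seq nat) : seq nat :=
  [seq (i \in A : nat) | i <- iota 0 6].

Definition base : seq nat := indic [:: 1; 2; 3].

Definition spoke (e : nat * nat) : seq nat := indic [:: 0; e.1; e.2].

Definition edges : seq (nat * nat) :=
  [seq (a, b) | a <- iota 1 5, b <- iota a.+1 (5 - a)].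

Definition spokes : seq (seq nat) := map spoke edges.

(* The edges ab of the x_0 x_a x_b. *)
Definition rep_graphs : seq (seq (nat * nat)) :=
  [:: [:: (1, 2); (1, 3); (1, 4); (1, 5); (2, 3)];
      [:: (1, 2); (1, 3); (1, 4); (1, 5); (2, 4)];
      [:: (1, 2); (1, 3); (1, 4); (1, 5); (4, 5)];
      [:: (1, 2); (1, 3); (1, 4); (2, 3); (2, 5)];
      [:: (1, 2); (1, 3); (1, 4); (2, 3); (4, 5)];
      [:: (1, 2); (1, 3); (1, 4); (2, 4); (2, 5)];
      [:: (1, 2); (1, 3); (1, 4); (2, 4); (3, 5)];
      [:: (1, 2); (1, 3); (1, 4); (2, 4); (4, 5)];
      [:: (1, 2); (1, 3); (2, 4); (2, 5); (4, 5)];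
      [:: (1, 2); (1, 3); (2, 4); (3, 5); (4, 5)];
      [:: (1, 2); (1, 4); (1, 5); (2, 4); (3, 4)];
      [:: (1, 2); (1, 4); (1, 5); (2, 4); (3, 5)];
      [:: (1, 2); (1, 4); (1, 5); (3, 4); (4, 5)];
      [:: (1, 2); (1, 4); (2, 4); (3, 4); (3, 5)];
      [:: (1, 2); (1, 4); (2, 4); (3, 4); (4, 5)];
      [:: (1, 2); (1, 4); (2, 4); (3, 5); (4, 5)];
      [:: (1, 2); (1, 4); (2, 5); (3, 4); (3, 5)];
      [:: (1, 2); (1, 4); (3, 4); (3, 5); (4, 5)];
      [:: (1, 4); (1, 5); (2, 4); (3, 4); (4, 5)];
      [:: (1, 4); (1, 5); (2, 4); (3, 5); (4, 5)]].

Definition reps : seq (seq (seq nat)) :=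
  [seq base :: map spoke E | E <- rep_graphs].

(* These relabellings fix 0 and preserve {1, 2, 3}: they suffice, as the 20
   classes remain 20 once the variable of degree five is marked. *)
Definition base_perms : seq (seq nat) :=
  [seq 0 :: p ++ q | p <- permutations [:: 1; 2; 3],
                     q <- permutations [:: 4; 5]].

Definition dot (w : seq int) (v : seq nat) : int :=
  foldr (fun x s => x.1 *+ x.2 + s)%R 0%R (zip w v).

(* Found by a greedy search among the weights with entries in [-2, 2]. *)
Definition weights : seq (seq int) :=
  [:: [:: -2; -2; 1; 1; 1; 1]; [:: -2; 0; 0; 0; 2; 2];
      [:: -2; 1; -2; 1; 1; 1]; [:: -2; 1; 1; -2; 1; 1];
      [:: -1; -1; -1; 2; -1; 2]; [:: -1; -1; -1; 2; 2; -1];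
      [:: -1; -1; -1; 2; 2; 2]; [:: -1; -1; 2; -1; -1; 2];
      [:: -1; -1; 2; -1; 2; -1]; [:: -1; -1; 2; -1; 2; 2];
      [:: -1; 2; -1; -1; -1; 2]; [:: -1; 2; -1; -1; 2; -1];
      [:: -1; 2; -1; -1; 2; 2]; [:: 0; 0; 0; 0; 1; 0]; [:: 0; 0; 0; 0; 0; 1]]%R.

Definition killed (V : seq (seq nat)) : bool :=
  has (fun w => all (fun v => dot w v == 0%R) V) weights.

(** Inclusion in a representative is enough to test: equal cardinalities turn it into equality in
    [normalizable_rep]. *)
Definition normalizable (V : seq (seq nat)) : bool :=
  has (fun p => has (fun r => all (fun v => pull p v \in r) V) reps) base_perms.

Fixpoint combs (T : Type) (k : nat) (s : seq T) : seq (seq T) :=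
  match k, s with
  | 0, _ => [:: [::]]
  | _, [::] => [::]
  | k'.+1, x :: s' => map (cons x) (combs k' s') ++ combs k s'
  end.

Lemma killed_or_normalizable :
  all (fun V => killed (base :: V) || normalizable (base :: V))
    (combs 5 spokes).
Proof. by vm_compute. Qed.

(** All 720 relabellings are tried, as an isomorphism is not assumed to fix x_0. *)
Lemma reps_non_iso :
  all (fun i => all (fun j => (i == j) ||
    ~~ has (fun p =>
          all (fun v => pull p v \in nth [::] reps j) (nth [::] reps i))
        (permutations (iota 0 6))) (iota 0 20)) (iota 0 20).
Proof. by vm_compute. Qed.

(** The determinant, expanded along the first row. Lists make it computable, and skipping zero
    entries prunes the recursion. *)
Fixpoint laplace (n : nat) (M : seq (seq int)) : int :=
  if n is n'.+1 then
    foldr (fun j s => let a := nth 0%R (head [::] M) j in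
      if a == 0%R then s else
        (-1) ^+ j * a * laplace n' [seq take j r ++ drop j.+1 r | r <- behead M]
        + s)%R 0%R (iota 0 n)
  else 1%R.

(* Cramer's rule serves only as an oracle for the exponents; [eqmod_by] checks
   its answer. *)
Definition cramer (V : seq (seq nat)) (t : seq int) : seq int :=
  let M := [seq map Posz v | v <- V] in
  [seq (laplace 6 (set_nth [::] M j t) %/ laplace 6 M)%Z | j <- iota 0 6].

Definition pospart (k : int) : nat := if k is Posz n then n else 0.

Definition negpart (k : int) : nat := if k is Negz n then n.+1 else 0.

Definition comb_nth (k : seq nat) (V : seq (seq nat)) (i : nat) : nat :=
  foldr (fun x s => x.1 * nth 0 x.2 i + s)%N 0 (zip k V).

(** The integer identity m - m' = sum of k_j V_j, with negative terms moved across so that it is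
    stated in natural numbers. *)
Definition eqmod_by (k : seq int) (V : seq (seq nat)) (m m' : seq nat) : bool :=
  all (fun i => nth 0 m i + comb_nth (map negpart k) V i
             == nth 0 m' i + comb_nth (map pospart k) V i)%N (iota 0 6).

(** For vectors of degree 3, this says that [V] generates the lattice of integer vectors whose sum
    is divisible by 3. *)
Definition spanning (V : seq (seq nat)) : bool :=
  let eqmodV m m' :=
    let t := [seq Posz (nth 0 m i) - Posz (nth 0 m' i) | i <- iota 0 6]%R in
    eqmod_by (cramer V t) V m m' in
  all (fun i => eqmodV (indic [:: i]) (indic [:: 0])) (iota 0 6)
  && eqmodV [:: 3] [::].

(** Collects what is required of a representative apart from the equality of fields; x_0 supplies
    the row with five ones. *)
Definition admissible (V : seq (seq nat)) : bool :=
  [&& size V == 6, uniq V,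
      all (fun v => [&& size v == 6, all (leq^~ 1) v & sumn v == 3]) V,
      all (fun i => has (fun v => nth 0 v i == 1) V
                 && has (fun v => nth 0 v i == 0) V) (iota 0 6)
    & count (fun v => nth 0 v 0 == 1) V == 5].

Lemma reps_admissible : all admissible reps.
Proof. by vm_compute. Qed.

Lemma reps_spanning : all spanning reps.
Proof. by vm_compute. Qed.

(** * The representatives are Cremona sets *)

Lemma all_nth_ord (n : nat) (P : pred nat) :
  all P (iota 0 n) -> forall i : 'I_n, P i.
Proof. by move=> /allP P_ i; apply: P_; rewrite mem_iota add0n ltn_ord. Qed.

Definition mon_comb (n : nat) (k : seq nat) (V : seq (seq nat)) : 'X_{1..n} :=
  (\sum_(x <- zip k V) expo n x.2 *+ x.1)%MM.

Lemma mon_combE n k V (i : 'I_n) : mon_comb n k V i = comb_nth k V i.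
Proof.
rewrite mnm_sumE /comb_nth; elim: (zip k V) => [|x s IHs].
  by rewrite big_nil.
by rewrite big_cons IHs mulmnE expoE mulnC.
Qed.

Lemma mon_alg_comb (K : fieldType) n k V :
  mon_alg (K := K) [pred m | m \in fset_of n V] 'X_[mon_comb n k V].
Proof.
have: {subset unzip2 (zip k V) <= V}.
  by elim: k V => [|a k IHk] [|v V] //= u; rewrite !inE => /orP[->|/IHk->];
    rewrite ?orbT.
rewrite /mon_comb; elim: (zip k V) => [|x s IHs] sV.
  by rewrite big_nil mpolyX0 -mpolyC1; apply: mon_algC.
rewrite big_cons mpolyXD; apply: mon_algM; last first.
  by apply: IHs => u su; apply: sV; rewrite inE su orbT.
have Fx: mon_alg (K := K) [pred m | m \in fset_of n V] 'X_[expo n x.2].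
  by apply/mon_alg_mon/mem_fset_of/sV; rewrite inE eqxx.
elim: x.1 => [|e IHe].
  by rewrite mulm0n mpolyX0 -mpolyC1; apply: mon_algC.
by rewrite mulmS mpolyXD; apply: mon_algM.
Qed.

Lemma eqmod_by_correct (K : fieldType) k V m m' :
  eqmod_by k V m m' -> eqmod K (fset_of 6 V) (expo 6 m) (expo 6 m').
Proof.
move=> /all_nth_ord e.
exists (mon_comb 6 (map pospart k) V), (mon_comb 6 (map negpart k) V).
split; try exact: mon_alg_comb.
by apply/mnmP => i; rewrite !mnmDE !mon_combE !expoE; apply/eqP/e.
Qed.

Lemma dotE n (w : seq int) (v : seq nat) : size w = n -> size v = n ->
  dot w v = (\sum_(i < n) nth 0 w i *+ nth 0%N v i)%R.
Proof.
elim: w v n => [|a w IHw] [|b v] [|n] //= sw sv; first by rewrite big_ord0.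
by rewrite big_ord_recl /= -IHw //; [case: sw | case: sv].
Qed.

Lemma expo_indic (i : 'I_6) : expo 6 (indic [:: val i]) = U_(i)%MM.
Proof.
apply/mnmP => j; rewrite expoE mnm1E (nth_map 0) ?size_iota //.
by rewrite nth_iota // inE eq_sym.
Qed.

Lemma expo_cube : expo 6 [:: 3] = (U_(@ord0 5) *+ 3)%MM.
Proof.
apply/mnmP => j; rewrite expoE mulmnE mnm1E.
by case: j => -[|[|[|[|[|[|j]]]]]].
Qed.

Lemma cremona_rep (K : fieldType) V : V \in reps ->
  [/\ cremona_set K 3 (fset_of 6 V), square_free (fset_of 6 V)
    & type2 (fset_of 6 V)].
Proof.
move=> Vr; have /and5P[/eqP sV uV /allP Vok /all_nth_ord canV rowV] :=
  allP reps_admissible _ Vr.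
have szV : all (fun v => size v == 6) V by apply/allP => v /Vok/and3P[].
have le1V v i : v \in V -> nth 0 v i <= 1.
  move=> /Vok/and3P[_ /all_nthP v1 _].
  by have [/v1->//|/(nth_default 0)->] := ltnP i (size v).
have pV := perm_fset_of uV szV.
split.
- have /andP[/all_nth_ord eU eU0] := allP reps_spanning _ Vr.
  apply: (@cremona_of_eqmod _ _ _ 3 ord0).
  + by rewrite (perm_size pV) size_map.
  + move=> m /fset_ofP[v Vv ->]; have /and3P[/eqP sv _ /eqP s3] := Vok _ Vv.
    by rewrite -(sumn_readout _ (perm_refl _)) readout_expo ?s3.
  + move=> i; have /andP[/hasP[u Vu /eqP ui] /hasP[v Vv /eqP vi]] := canV i.
    split; [exists (expo 6 u) | exists (expo 6 v)]; try exact: mem_fset_of.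
      by rewrite lep1mP expoE ui.
    by rewrite lep1mP expoE vi.
  + by move=> i; rewrite -!expo_indic; apply: eqmod_by_correct (eU i).
  + have -> : 0%MM = expo 6 [::].
      by apply/mnmP => i; rewrite expoE nth_nil mnm0E.
    by rewrite -expo_cube; apply: eqmod_by_correct eU0.
- apply/square_freeP => m i /fset_ofP[v Vv ->]; rewrite expoE; exact: le1V.
- exists ord0; rewrite card_log_matrix1 (seq.permP pV) count_map -(eqP rowV).
  by apply: eq_count => v /=; rewrite expoE.
Qed.

(** * Reduction of a Cremona set to a representative *)

Lemma combs_subseq (T : eqType) (c s : seq T) :
  subseq c s -> c \in combs (size c) s.
Proof.
elim: s c => [|x s IHs] [|y c] //=; rewrite ?inE //.
rewrite mem_cat; case: eqP => [->|_] sc; last first.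
  by rewrite [_ \in combs _ s]IHs ?orbT.
by apply/orP; left; apply/mapP; exists c => //; apply: IHs.
Qed.

(** Splitting each entry into 0, 1 or at least 2 leaves finitely many cases, all settled by
    computation. *)
Lemma spoke_of_vector (v : seq nat) :
    size v = 6 -> all (leq^~ 1) v -> sumn v = 3 -> nth 0 v 0 = 1 ->
  v \in spokes.
Proof.
by case: v => [|[|[|a]] [|[|[|b]] [|[|[|c]] [|[|[|d]]
  [|[|[|e]] [|[|[|f]] [|g v]]]]]]].
Qed.

(* The variable dividing five of the monomials becomes 0 and the remaining
   monomial becomes x_1 x_2 x_3. *)
Lemma normal_position (F : {fset 'X_{1..6}}) :
    #|` F| = 6 -> same_degree 3 F -> square_free F -> type2 F ->
  exists p, perm_eq p (enum 'I_6) /\ exists2 V, V \in combs 5 spokes &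
    [seq readout p m | m <- F] =i base :: V.
Proof.
move=> sF dF /square_freeP le1F [i0]; rewrite card_log_matrix1 => row5.
have : has (fun m : 'X_{1..6} => m i0 != 1) F.
  (* Of the six monomials five contain x_i0; [addKn] writes the number of the others as 6 - 5. *)
  have := count_predC (fun m : 'X_{1..6} => m i0 == 1) F.
  by rewrite row5 sF has_count -[X in _ < X](addKn 5) => ->.
case/hasP => m0 Fm0 m0i0.
have {}m0i0 : m0 i0 = 0 by have := le1F _ i0 Fm0; case: (m0 i0) m0i0 => [|[]].
(* Listing x_i0, then the support of [m0], then the other variables makes [m0] read 0, 1, 1, 1, 0,
   0. *)
pose B := [seq i <- enum 'I_6 | m0 i != 0].
pose C := [seq i <- enum 'I_6 | (m0 i == 0) && (i != i0)].
pose p := i0 :: B ++ C; exists p.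
have pE : perm_eq p (enum 'I_6).
  apply: uniq_perm; last 1 first.
  - move=> i; rewrite mem_enum in_cons mem_cat.
    rewrite mem_filter mem_enum mem_filter mem_enum !andbT.
    by case: (eqVneq i i0) => //= _; case: eqP.
  - rewrite /= mem_cat !mem_filter m0i0 !eqxx /= cat_uniq.
    rewrite !(filter_uniq _ (enum_uniq _)) // andbT; apply/hasPn => i.
    rewrite mem_filter => /andP[/andP[/eqP m0i _] _].
    by rewrite mem_filter m0i.
  - exact: enum_uniq.
split=> //.
have p_m0 : readout p m0 = base.
  have rB : readout B m0 = nseq (size B) 1.
    rewrite -(size_map (fun i => m0 i) B); apply/all_pred1P/allP => x /mapP[i].
    rewrite mem_filter => /andP[+ _ ->].
    by have := le1F _ i Fm0; case: (m0 i) => [|[]].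
  have rC : readout C m0 = nseq (size C) 0.
    rewrite -(size_map (fun i => m0 i) C); apply/all_pred1P/allP => x /mapP[i].
    by rewrite mem_filter => /andP[/andP[/eqP m0i _] _ ->]; rewrite /= m0i.
  have e : readout p m0 = 0 :: nseq (size B) 1 ++ nseq (size C) 0.
    by rewrite /readout /= m0i0 map_cat -!/(readout _ _) rB rC.
  have sB : size B = 3.
    have := dF _ Fm0; rewrite -(sumn_readout m0 pE) e /= sumn_cat !sumn_nseq.
    by rewrite mul1n mul0n addn0.
  have sC : size C = 2.
    by have := perm_size pE; rewrite size_enum_ord /= size_cat sB => -[].
  by rewrite e sB sC.
pose W := [seq readout p m | m <- F].
have uW : uniq W by rewrite map_inj_uniq ?fset_uniq //; apply: readout_inj.
have Wb : base \in W by rewrite -p_m0 map_f.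
have pW := perm_to_rem Wb.
have szW : size (rem base W) = 5.
  by have := perm_size pW; rewrite size_map sF => -[].
have headW : all (fun v => nth 0 v 0 == 1) (rem base W).
  rewrite all_count szW -row5.
  have /esym := seq.permP pW (fun v => nth 0 v 0 == 1).
  rewrite /= add0n count_map => ->; apply/eqP/eq_count => m //=.
(* The remaining vectors are put in the order of [spokes], since [combs] only lists subsequences. *)
pose V := [seq v <- spokes | v \in rem base W].
have Wspoke : {subset rem base W <= spokes}.
  move=> v Wv; have /mapP[m Fm ev] := mem_rem Wv.
  apply: spoke_of_vector; last exact/eqP/(allP headW).
  - by rewrite ev size_map (perm_size pE) size_enum_ord.
  - by rewrite ev; apply/allP => x /mapP[i _ ->]; apply: le1F.
  - by rewrite ev sumn_readout ?dF.
have VW : V =i rem base W.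
  by move=> v; rewrite mem_filter andb_idr //; apply: Wspoke.
have sV : size V = 5.
  rewrite -szW; apply/perm_size/uniq_perm; rewrite ?rem_uniq //.
  exact: filter_uniq.
exists V; first by rewrite -{1}sV; apply/combs_subseq/filter_subseq.
by move=> v; rewrite (perm_mem pW) !inE VW.
Qed.

Lemma killed_degenerate (F : {fset 'X_{1..6}}) p V (K : fieldType) :
    perm_eq p (enum 'I_6) -> [seq readout p m | m <- F] =i V -> killed V ->
  ~ cremona_set K 3 F.
Proof.
move=> pE FV /hasP[w ww /allP wV] crF.
have [sw w0] : size w = 6 /\ has (predC1 0%R) w.
  have : all (fun w => (size w == 6) && has (predC1 0%R) w) weights by [].
  by move=> /allP/(_ _ ww)/andP[/eqP].
have sp : size p = 6 by rewrite (perm_size pE) size_enum_ord.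
have up : uniq p by rewrite (perm_uniq pE) enum_uniq.
(* The weight is carried back along [p]: the j-th variable of [p] receives the j-th entry of [w]. *)
have wF m : m \in F -> weight (fun i => nth 0%R w (index i p)) m = 0%R.
  move=> Fm; have := wV (readout p m); rewrite -FV map_f // => /(_ isT)/eqP.
  rewrite (@dotE 6) ?size_map // => e; rewrite -[RHS]e /weight.
  rewrite -big_enum -(perm_big _ pE) /=.
  rewrite (big_nth ord0) sp big_mkord; apply: eq_bigr => i _.
  by rewrite index_uniq ?sp // (nth_map ord0) ?sp ?ltn_ord.
have := cremona_weight (isT : 0 < 3) crF wF.
case/hasP: w0 => x /(nthP 0%R)[j]; rewrite sw => jw <- /= /negP wj0.
by move=> /(_ (nth ord0 p j)); rewrite index_uniq ?sp // => /eqP/wj0.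
Qed.

Lemma normalizable_rep (F : {fset 'X_{1..6}}) p V :
    perm_eq p (enum 'I_6) -> #|` F| = 6 ->
    [seq readout p m | m <- F] =i V -> normalizable V ->
  exists2 r, r \in reps & mon_iso F (fset_of 6 r).
Proof.
move=> pE sF FV /hasP[q qs /hasP[r rr /allP Vr]]; exists r => //.
have qE : perm_eq q (iota 0 6).
  have : all (fun q => perm_eq q (iota 0 6)) base_perms by [].
  by move=> /allP/(_ _ qs).
have sp : size p = 6 by rewrite (perm_size pE) size_enum_ord.
pose pq := [seq nth ord0 p j | j <- q].
have pqE : perm_eq pq (enum 'I_6).
  apply: perm_trans pE; apply: perm_trans (perm_map _ qE) _.
  by rewrite -{2}[p](mkseq_nth ord0) sp.
apply: (mon_iso_readout pqE).
have pullE m : readout pq m = pull q (readout p m).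
  rewrite /readout /pull -map_comp; apply/eq_in_map => j.
  rewrite (perm_mem qE) mem_iota => jn.
  by rewrite /= (nth_map ord0) ?sp ?ltn_ord.
(* Six distinct vectors included in a list of six exhaust it. *)
apply: (uniq_min_size _ _ _).2.
- by rewrite map_inj_uniq ?fset_uniq //; apply: readout_inj.
- by move=> _ /mapP[m Fm ->]; rewrite pullE; apply: Vr; rewrite -FV map_f.
- have /and5P[/eqP-> _ _ _ _] := allP reps_admissible _ rr.
  by rewrite size_map sF.
Qed.

Theorem proposition4p6 (K : fieldType) :
  exactly_up_to (@mon_iso 6) 20
    (fun F : {fset 'X_{1..6}} =>
       cremona_set K 3 F /\ square_free F /\ type2 F).
Proof.
exists (fun i : 'I_20 => fset_of 6 (nth [::] reps i)); split.
- by move=> i; have [] := @cremona_rep K (nth [::] reps i); rewrite ?mem_nth.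
- move=> i j.
  have szr k : all (fun v => size v == 6) (nth [::] reps (k : 'I_20)).
    have /(allP reps_admissible)/and5P[_ _ /allP rk _ _] :
      nth [::] reps k \in reps by rewrite mem_nth.
    by apply/allP => v /rk/and3P[].
  move=> /(mon_iso_fset_of (szr j))[p pp prj].
  have := reps_non_iso.
  move=> /all_nth_ord/(_ i)/all_nth_ord/(_ j)/orP[/eqP/val_inj//|/hasP[]].
  by exists p.
- move=> F [crF [sqF t2F]]; have [sF dF _ _] := crF.
  have [p [pE [V Vc FV]]] := normal_position sF dF sqF t2F.
  have /orP[/(killed_degenerate pE FV)/(_ crF)//|] :=
    allP killed_or_normalizable _ Vc.
  move=> /(normalizable_rep pE sF FV)[r /(nthP [::])[k k20 <-] isoF].
  by exists (Ordinal k20).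
Qed.
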